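(* Let $X$ be a Hausdorff space, let $\tau^c$ be the family of all closed subsets of $X$ and $\mathcal S_X=\{\{x\}:x\in X\}$. Let $Y$ be a Hausdorff space with a strictly increasing closed cover $\{B_n\}_{n\in\mathbb N}$. The following are equivalent. (a) $X$ is $o$-semimetrizable. (b) There exists a map $\phi:\tau^c\to\mathcal L(X,\mathcal F(Y))$, $F\mapsto\phi_F$ (with $\phi_x:=\phi_{\{x\}}$), such that: $F=\bigcap_{n\in\mathbb N}\phi_F^{-1}[Y\setminus B_n]$ for each $F\in\tau^c$; if $F_1,F_2\in\tau^c$ and $F_1\subset F_2$, then $\phi_{F_1}(x)\subset\phi_{F_2}(x)$ for all $x\in X$; and $\phi_x(y)=\phi_y(x)$ for all $x,y\in X$. (c) There exists a map $\phi:\mathcal S_X\to\mathcal L(X,\mathcal F(Y))$, $\{x\}\mapsto\phi_x$, such that: $\{x\}=\bigcap_{n\in\mathbb N}\phi_x^{-1}[Y\setminus B_n]$ for each $x\in X$; for each $x\in X$ and $F\in\tau^c$ with $x\notin F$, $\phi_x$ is bounded on $F$; and $\phi_x(y)=\phi_y(x)$ for all $x,y\in X$.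
   Context: $\mathbb N$ is the set of positive integers. A sequence $\{B_n\}_{n\in\mathbb N}$ of closed subsets of a space $Y$ is a strictly increasing closed cover of $Y$ if $Y=\bigcup_{n}B_n$, $B_1\neq\emptyset$ and $B_n\subsetneq B_{n+1}$ for each $n$. $\mathcal F(Y)$ is the family of nonempty closed subsets of $Y$. For a set-valued map $\psi:X\to\mathcal F(Y)$ and $B\subset Y$, $\psi^{-1}[B]=\{x\in X:\psi(x)\cap B\neq\emptyset\}$ and $\psi^{\#}[B]=\{x\in X:\psi(x)\subset B\}$. $\psi$ is lower semi-continuous if $\psi^{-1}[V]$ is open in $X$ for each open $V\subset Y$; $\mathcal L(X,\mathcal F(Y))$ is the set of all lower semi-continuous maps $X\to\mathcal F(Y)$. $\psi$ is bounded on $A\subset X$ if $A\subset\psi^{\#}[B_n]$ for some $n\in\mathbb N$. A semi-metric on a space $X$ is a function $d:X\times X\to[0,\infty)$ such that (1) $d(x,y)=0$ if and only if $x=y$; (2) $d(x,y)=d(y,x)$ for all $x,y\in X$; (3) for each $x\in X$, $\{B(x,r):r>0\}$ is a neighborhood base of $x$, where $B(x,r)=\{y\in X:d(x,y)<r\}$. $X$ is $o$-semimetrizable if there is a semi-metric on $X$ such that $B(x,r)$ is open for each $x\in X$ and $r>0$. *)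

(* Defs.v *)
From HB Require Import structures.
From mathcomp Require Import all_boot all_order all_algebra.
From mathcomp Require Import boolp classical_sets functions reals topology.

Set Implicit Arguments.
Unset Strict Implicit.
Unset Printing Implicit Defensive.

Import Order.TTheory GRing.Theory Num.Theory.
Local Open Scope classical_set_scope.
Local Open Scope ring_scope.

(* Sequences indexed by the positive integers are indexed here by [nat]:
   [B n] stands for the member of index n + 1, so [B 0] is the first one. *)
Definition strictly_increasing_closed_cover (Y : topologicalType)
    (B : nat -> set Y) : Prop :=
  [/\ forall n, closed (B n),
      \bigcup_n B n = [set: Y],
      B 0%N !=set0
    & forall n, B n `<` B n.+1].

Definition closed_sets (X : topologicalType) : set (set X) :=
  [set F | closed F].

Definition singleton_sets (X : Type) : set (set X) :=
  [set [set x] | x in [set: X]].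

Definition nonempty_closed_sets (Y : topologicalType) : set (set Y) :=
  [set F | closed F /\ F !=set0].

Definition lower_preimage (X Y : Type) (psi : X -> set Y) (B : set Y) : set X :=
  [set x | psi x `&` B !=set0].

Definition upper_preimage (X Y : Type) (psi : X -> set Y) (B : set Y) : set X :=
  [set x | psi x `<=` B].

Definition lsc (X Y : topologicalType) (psi : X -> set Y) : Prop :=
  forall V : set Y, open V -> open (lower_preimage psi V).

(* The set-valued maps X -> F(Y) are the functions X -> set Y all of whose
   values are nonempty and closed. *)
Definition lsc_maps (X Y : topologicalType) : set (X -> set Y) :=
  [set psi | (forall x, nonempty_closed_sets (psi x)) /\ lsc psi].
Arguments lsc_maps : clear implicits.

Definition bounded_on (X Y : Type) (B : nat -> set Y) (psi : X -> set Y)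
    (A : set X) : Prop :=
  exists n, A `<=` upper_preimage psi (B n).

Definition sball (R : realType) (X : Type) (d : X -> X -> R) (x : X) (r : R) :
    set X :=
  [set y | d x y < r].

Definition semimetric (R : realType) (X : topologicalType) (d : X -> X -> R) :
    Prop :=
  [/\ forall x y, 0 <= d x y,
      forall x y, d x y = 0 <-> x = y,
      forall x y, d x y = d y x
    & forall x, (forall r : R, 0 < r -> nbhs x (sball d x r)) /\
        (forall U, nbhs x U -> exists2 r : R, 0 < r & sball d x r `<=` U)].

Definition o_semimetrizable (R : realType) (X : topologicalType) : Prop :=
  exists2 d : X -> X -> R, semimetric d &
    forall (x : X) (r : R), 0 < r -> open (sball d x r).

(* Main.v *)
Require Import Defs.
From mathcomp Require Import all_boot all_order all_algebra.
From mathcomp Require Import boolp classical_sets functions reals topology.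

Local Open Scope classical_set_scope.

Import Order.TTheory GRing.Theory Num.Theory.

(** Both the distance in (a) and the maps in (b) and (c) encode the same object:
    a decreasing sequence of open neighbourhoods [G n x] of each point [x],
    symmetric in the sense that [y] is in [G n x] exactly when [x] is in [G n y],
    and forming a neighbourhood base at [x] ([open_symmetric_base]).

    From a semi-metric with open balls one takes the balls of radius 1/(n+1)
    ([semimetrizable_base]).  Conversely, setting d(x, y) to the infimum of the
    1/(m+1) such that [y] still lies in the m-th neighbourhood of [x] turns the
    balls into unions of these neighbourhoods, hence into open sets
    ([base_o_semimetrizable]); the points are separated because they are closed.

    To get the maps of (b), thicken a closed set [F] to the open sets
    U_n(F), the union of the [G n x] over the [x] in [F].  Symmetry gives that
    the U_n(F) intersect to [F]: a point of all of them has points of [F] in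
    each of its own basic neighbourhoods ([base_bigcap]).  Then [phi F x] is the
    intersection of those [B n] for which [x] is outside U_n(F)
    ([layered_map]): the value grows with the depth of [x] and leaves
    every [B n] exactly when [x] is in all U_n(F), that is in [F].

    (b) implies (c) by restriction to singletons: if [x] is outside [F] then
    [phi F x] is inside some [B n], and for [y] in [F] symmetry and
    monotonicity give phi_x(y) = phi_y(x) inside [phi F x] ([maps_bounded]).

    Finally (c) yields a base again: [G n x] is the set of [y] at which phi_x
    leaves [B n].  It is open by lower semi-continuity, and boundedness of phi_x
    on the complement of an open neighbourhood [W] of [x] says that some [G n x]
    is contained in [W] ([base_of_maps]). *)

Set Implicit Arguments.
Unset Strict Implicit.
Unset Printing Implicit Defensive.

(** * Maps built from a sequence of open sets *)

Lemma cover_homo (Y : topologicalType) (B : nat -> set Y) :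
  strictly_increasing_closed_cover B ->
  forall m n, (m <= n)%N -> B m `<=` B n.
Proof.
move=> [_ _ _ Bs]; apply: (homo_leq (fun A => @subset_refl _ A)).
  by move=> A C D; apply: subset_trans.
by move=> n; case: (Bs n).
Qed.

(** When [U] decreases, [B] increases and [n] is the first index with [x] outside
    [U n], this is just [B n]; an intersection avoids choosing that index and gives
    the whole of [Y], the empty intersection, at the points of all the [U n]. *)
Definition layered_map (X Y : Type) (U : nat -> set X) (B : nat -> set Y)
    (x : X) : set Y :=
  \bigcap_(n in [set n | ~ U n x]) B n.

Lemma layered_map_homo (X Y : Type) (U U' : nat -> set X) (B : nat -> set Y) :
  (forall n, U n `<=` U' n) ->
  forall x, layered_map U B x `<=` layered_map U' B x.
Proof. by move=> UU' x v Hv n U'nx; apply: Hv => /UU'. Qed.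

(** If [x] is outside [U n], the value at [x] lies in [B n]; if [x] is in every
    [U n], the value is the whole of [Y], which no [B n] contains because the
    cover increases strictly. *)
Lemma bigcap_layered_map (X Y : topologicalType) (U : nat -> set X)
    (B : nat -> set Y) :
  strictly_increasing_closed_cover B ->
  \bigcap_n lower_preimage (layered_map U B) (~` B n) = \bigcap_n U n.
Proof.
move=> [_ _ _ Bs]; apply/seteqP; split => [x Hx n _|x Ux n _].
  have [v [vx vB]] := Hx n I.
  by apply: contrapT => nU; apply: vB; apply: vx.
have [_ /nonsubset[v [_ vB]]] := Bs n.
by exists v; split => // m /(_ (Ux m I)).
Qed.

(** A point [v] belongs to the value at [x] when [x] lies in every [U n] whose
    [B n] misses [v].  As the cover increases and reaches [v], only finitely many
    [n] are concerned, so these [x] form an open set. *)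
Lemma layered_map_lsc (X Y : topologicalType) (U : nat -> set X)
    (B : nat -> set Y) :
  strictly_increasing_closed_cover B -> (forall n, open (U n)) ->
  lsc_maps X Y (layered_map U B).
Proof.
move=> hB oU; have Bh := cover_homo hB; case: hB => Bc Bcov [b Bb] _.
split=> [x|V oV].
  split; first by apply: closed_bigI => n _; apply: Bc.
  by exists b => n _; apply: Bh Bb.
have -> : lower_preimage (layered_map U B) V =
    \bigcup_(v in V) \bigcap_(n in [set n | ~ B n v]) U n.
  apply/seteqP; split=> [x [v [vx Vv]]|x [v Vv vx]]; exists v => //.
    by move=> n nB; apply: contrapT => /vx.
  by split=> // n nU; apply: contrapT => /vx.
apply: bigcup_open => v _.
(* The cover reaches v at m, which bounds the indices n with v outside B n. *)
have [m _ Bmv] : (\bigcup_n B n) v by rewrite Bcov.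
have -> : \bigcap_(n in [set n | ~ B n v]) U n =
    \big[setI/setT]_(n < m) (if `[< B n v >] then setT else U n).
  rewrite -(bigcap_mkord m (fun n => if `[< B n v >] then setT else U n)).
  apply/seteqP; split=> x Hx n /= Hn.
    by case: asboolP => // nB; apply: Hx.
  have nm : (n < m)%N by rewrite ltnNge; apply/negP => /Bh /(_ _ Bmv).
  by have := Hx n nm; case: asboolP.
elim/big_ind: _ => [||n _]; [exact: openT|exact: openI|].
by case: asboolP => _; [exact: openT|exact: oU].
Qed.

(** * Symmetric neighbourhood bases and semi-metrics *)

Definition open_symmetric_base (X : topologicalType) (G : nat -> X -> set X) :
    Prop :=
  [/\ forall n x, open (G n x) /\ G n x x,
      forall n x, G n.+1 x `<=` G n x,
      forall n x y, G n x y -> G n y x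
    & forall x U, nbhs x U -> exists n, G n x `<=` U].

Lemma semimetrizable_base (R : realType) (X : topologicalType) :
  o_semimetrizable R X -> exists G : nat -> X -> set X, open_symmetric_base G.
Proof.
case=> d [d0 dE dC db] dopen.
have e0 n : (0 < n.+1%:R^-1 :> R)%R by rewrite invr_gt0 ltr0n.
exists (fun n x => sball d x n.+1%:R^-1%R); split=> [n x|n x y|n x y|x U /(db x).2].
- by split; [exact: dopen|rewrite /sball /= (dE x x).2].
- by move=> /lt_trans; apply; rewrite ltf_pV2 ?posrE ?ltr0n // ltr_nat.
- by rewrite /sball /= dC.
- case=> r r0 rU; have [n] := ltr_add_invr r0; rewrite add0r => nr.
  by exists n => y yn; apply: rU; apply: lt_trans nr.
Qed.

(** By symmetry, a point of the n-th thickening of [F] has a point of [F] in its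
    own n-th neighbourhood; if this holds for all [n], the point is in the closure
    of [F]. *)
Lemma base_bigcap (X : topologicalType) (G : nat -> X -> set X) (F : set X) :
  open_symmetric_base G -> closed F -> \bigcap_n \bigcup_(x in F) G n x = F.
Proof.
move=> [G1 _ Gs Gb] cF; apply/seteqP; split=> [y Hy|y Fy n _]; last first.
  by exists y => //; case: (G1 n y).
apply: contrapT => nFy.
have [n Gn] : exists n, G n y `<=` ~` F.
  by apply: Gb; apply: open_nbhs_nbhs; split=> //; exact: closed_openC.
by have [x Fx /Gs /Gn] := Hy n I.
Qed.

Section semimetric_of_base.
Variables (R : realType) (X : topologicalType) (G : nat -> X -> set X).
Hypotheses (hX : accessible_space X) (hG : open_symmetric_base G).

(** The sequence is shifted to start with the whole space, so that any two points
    have at least one radius and the infimum below is that of a nonempty set. *)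
Let V n x : set X := if n is k.+1 then G k x else setT.

Definition base_radii (x y : X) : set R :=
  [set n.+1%:R^-1%R | n in [set n | V n x y]].

Definition base_dist (x y : X) : R := inf (base_radii x y).

Let radii_lb x y : lbound (base_radii x y) 0%R.
Proof. by move=> _ [n _ <-]; rewrite invr_ge0. Qed.

Let radii_ne x y : base_radii x y !=set0.
Proof. by exists 1%:R^-1%R, 0%N. Qed.

(** The infimum is below [r] exactly when one of the radii is, whether or not it
    is attained. *)
Lemma sball_base x (r : R) :
  sball base_dist x r = \bigcup_(n in [set n | (n.+1%:R^-1 < r)%R]) V n x.
Proof.
apply/seteqP; split=> [y /(inf_lt (radii_ne x y))[_ [n Vn <-]] nr|y [n nr Vn]].
  by exists n.
apply: le_lt_trans nr; apply: ge_inf; first by exists 0%R; exact: radii_lb.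
by exists n.
Qed.

Lemma base_o_semimetrizable : o_semimetrizable R X.
Proof.
case: hG => G1 Gd Gs Gb.
have e0 n : (0 < n.+1%:R^-1 :> R)%R by rewrite invr_gt0 ltr0n.
have Gh x m n : (m <= n)%N -> G n x `<=` G m x.
  apply: (@homo_leq _ (fun k => G k x) (fun A C => C `<=` A)) => [|A C D CA DC|//].
    exact: subset_refl.
  exact: subset_trans DC CA.
have VC n x y : V n x y -> V n y x by case: n => //= n; apply: Gs.
have Vo n x : open (V n x) by case: n => [|n]; [exact: openT|case: (G1 n x)].
have Vx n x : V n x x by case: n => [|n] //; case: (G1 n x).
have oball x (r : R) : open (sball base_dist x r).
  by rewrite sball_base; apply: bigcup_open => n _; apply: Vo.
have ballx x (r : R) : (0 < r)%R -> sball base_dist x r x.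
  move=> r0; rewrite sball_base; have [n] := ltr_add_invr r0.
  by rewrite add0r => nr; exists n.
have ballG x n : sball base_dist x n.+1%:R^-1%R `<=` G n x.
  rewrite sball_base => y [m /=].
  rewrite ltf_pV2 ?posrE ?ltr0n // ltr_nat ltnS.
  by case: m => // m nm; apply: Gh.
have d0 x y : (0 <= base_dist x y)%R.
  by apply: lb_le_inf; [exact: radii_ne|exact: radii_lb].
exists base_dist => [|x r _]; last exact: oball.
split=> // [x y|x y|x].
- split=> [dxy|->]; last first.
    apply/eqP; rewrite eq_le d0 andbT; apply/ler_addgt0Pr => e ee.
    by rewrite add0r; apply: ltW; exact: ballx.
  (* Then y is in all G n x, whose intersection is the closed set {x}. *)
  have : (\bigcap_n \bigcup_(z in [set x]) G n z) y.
    move=> n _; exists x => //; apply: ballG.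
    by rewrite /sball /= dxy.
  by rewrite (base_bigcap hG) => [->|] //; exact: @accessible_closed_set1 _ hX x.
- have -> // : base_dist x y = base_dist y x.
  congr (inf _); apply/seteqP.
  by split=> _ [n Vn <-]; exists n => //; apply: VC.
- split=> [r r0|U /Gb[n GU]].
    by apply: open_nbhs_nbhs; split; [exact: oball|exact: ballx].
  by exists n.+1%:R^-1%R => //; apply: subset_trans GU.
Qed.

End semimetric_of_base.

(** * Passing between bases and set-valued maps *)

Lemma maps_of_base (X Y : topologicalType) (B : nat -> set Y)
    (G : nat -> X -> set X) :
  strictly_increasing_closed_cover B -> open_symmetric_base G ->
  exists phi : {fun @closed_sets X >-> lsc_maps X Y},
    [/\ forall F : set X, closed F ->
          F = \bigcap_n lower_preimage (phi F) (~` B n),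
        forall F1 F2 : set X, closed F1 -> closed F2 -> F1 `<=` F2 ->
          forall x : X, phi F1 x `<=` phi F2 x
      & forall x y : X, phi [set x] y = phi [set y] x].
Proof.
move=> hB hG; case: (hG) => G1 _ Gs _.
(* The open thickenings of F. *)
pose U F n := \bigcup_(x in F) G n x.
have phiP : {homo (fun F => layered_map (U F) B) :
    F / closed_sets F >-> lsc_maps X Y F}.
  move=> F _; apply: layered_map_lsc => // n.
  by apply: bigcup_open => x _; case: (G1 n x).
exists (mkfun phiP); rewrite /mkfun; split=> [F cF|F1 F2 _ _ F12|x y].
- by rewrite bigcap_layered_map // base_bigcap.
- by apply: layered_map_homo => n; apply: bigcup_subset.
- have UC z w n : U [set z] n w -> U [set w] n z.
    by rewrite /U !bigcup_set1; exact: Gs.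
  by apply/seteqP; split=> v Hv n nU; apply: Hv => /UC.
Qed.

(** The bound on [F] is read off at the single point [x]: symmetry exchanges the
    value of phi_x at [y] with that of phi_y at [x], which monotonicity places
    inside [phi F x]. *)
Lemma maps_bounded (X Y : topologicalType) (B : nat -> set Y)
    (phi : set X -> X -> set Y) (F : set X) (x : X) :
  (forall x : X, closed [set x]) ->
  (forall F : set X, closed F ->
     F = \bigcap_n lower_preimage (phi F) (~` B n)) ->
  (forall F1 F2 : set X, closed F1 -> closed F2 -> F1 `<=` F2 ->
     forall x : X, phi F1 x `<=` phi F2 x) ->
  (forall x y : X, phi [set x] y = phi [set y] x) ->
  closed F -> ~ F x -> bounded_on B (phi [set x]) F.
Proof.
move=> c1 phiE phiS phiC cF nFx.
have [n nB] : exists n, ~ lower_preimage (phi F) (~` B n) x.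
  apply/existsNP => Hx; apply: nFx; rewrite (phiE F cF) => n _; exact: Hx.
exists n => y Fy v; rewrite phiC => yv; apply: contrapT => nBv; apply: nB.
by exists v; split=> //; apply: phiS yv => // _ ->.
Qed.

(** An inclusion of the n-th set in an open [W] is precisely the bound [B n] for
    phi_x on the closed complement of [W]. *)
Lemma base_of_maps (X Y : topologicalType) (B : nat -> set Y)
    (phi : X -> X -> set Y) :
  strictly_increasing_closed_cover B ->
  (forall x, lsc (phi x)) ->
  (forall x, (\bigcap_n lower_preimage (phi x) (~` B n)) x) ->
  (forall (x : X) (F : set X), closed F -> ~ F x -> bounded_on B (phi x) F) ->
  (forall x y : X, phi x y = phi y x) ->
  open_symmetric_base (fun n x => lower_preimage (phi x) (~` B n)).
Proof.
move=> hB lphi phi1 phib phiC; have Bh := cover_homo hB; case: hB => Bc _ _ _.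
split=> [n x|n x y|n x y|x U].
- split; last exact: phi1.
  by apply: lphi; apply: closed_openC.
- by case=> v [vy nB]; exists v; split=> // /(Bh _ _ (leqnSn n)).
- by rewrite /lower_preimage /= phiC.
- rewrite nbhsE => -[W [oW Wx] WU].
  have [n bn] : bounded_on B (phi x) (~` W).
    by apply: phib; [exact: open_closedC|move/(_ Wx)].
  exists n => y [v [vy nB]]; apply: WU; apply: contrapT => nWy.
  by apply: nB; apply: bn vy.
Qed.

Unset Implicit Arguments.
Set Strict Implicit.
Set Printing Implicit Defensive.

Theorem theorem4p3 (R : realType) (X Y : topologicalType) (B : nat -> set Y)
    (hX : hausdorff_space X) (hY : hausdorff_space Y)
    (hB : strictly_increasing_closed_cover B) :
  [<-> o_semimetrizable R X;
       exists phi : {fun @closed_sets X >-> lsc_maps X Y},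
         [/\ forall F : set X, closed F ->
               F = \bigcap_n lower_preimage (phi F) (~` B n),
             forall F1 F2 : set X, closed F1 -> closed F2 -> F1 `<=` F2 ->
               forall x : X, phi F1 x `<=` phi F2 x
           & forall x y : X, phi [set x] y = phi [set y] x];
       exists phi : {fun @singleton_sets X >-> lsc_maps X Y},
         [/\ forall x : X,
               [set x] = \bigcap_n lower_preimage (phi [set x]) (~` B n),
             forall (x : X) (F : set X), closed F -> ~ F x ->
               bounded_on B (phi [set x]) F
           & forall x y : X, phi [set x] y = phi [set y] x]].
Proof.
have c1 (x : X) : closed [set x].
  exact: accessible_closed_set1 (hausdorff_accessible hX) x.
tfae.
- by move=> /semimetrizable_base[G hG]; exact: maps_of_base hB hG.
- case=> phi [phiE phiS phiC].
  have phi1 : {homo (phi : set X -> X -> set Y) :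
      F / singleton_sets F >-> lsc_maps X Y F}.
    by move=> _ [x _ <-]; apply: funS; apply: c1.
  exists (mkfun phi1); rewrite /mkfun; split=> //.
    by move=> x; apply: phiE; apply: c1.
  by move=> x F cF nFx; apply: maps_bounded.
- case=> phi [phiE phib phiC].
  apply: base_o_semimetrizable (hausdorff_accessible hX) _.
  apply: (@base_of_maps _ _ B (fun x => phi [set x])) => // [x|x].
    have [] // : lsc_maps X Y (phi [set x]) by apply: funS; exists x.
  by rewrite -phiE.
Qed.
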